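(* The following are equivalent for a commutative semiring $R$ (in particular for a commutative ring $R$): (1) $R$ is a PAMin-semiring; (2) $R$ is a PBMax-semiring; (3) $\mathrm{Spec}(R)$ is discrete; (4) $\mathrm{Spec}(R)$ is discrete and finite; (5) $\mathrm{Spec}(R)$ is finite and $T_1$ (respectively: finite and $R_0$; finite and $R_1$; finite and $T_2$); (6) $R$ is an FMax-semiring and $\mathrm{Spec}(R)$ is $T_1$ (respectively: $R_0$; $R_1$; $T_2$); (7) $\mathrm{Max}(R)$ is discrete and $K.\dim(R)=0$; (8) $R$ is a BMax-semiring and $K.\dim(R)=0$; (9) $R$ is an FMin-semiring and $\mathrm{Spec}(R)$ is $T_1$ (respectively: $R_0$; $R_1$; $T_2$); (10) $\mathrm{Min}(R)$ is discrete and $K.\dim(R)=0$; (11) $R$ is an AMin-semiring and $K.\dim(R)=0$. Here each ''respectively'' variant is itself one of the equivalent conditions.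
   Context: A semiring is a set $R$ with operations $+,\cdot$ such that $(R,+,0)$ is a commutative monoid, $(R,\cdot,1)$ is a monoid, multiplication distributes over addition from both sides, $0r=0=r0$ for all $r\in R$, and $1\ne 0$; it is commutative if $\cdot$ is. Every ring (with $1\ne0$) is a semiring. An ideal of a commutative semiring is an additive submonoid closed under multiplication by $R$; prime and maximal ideals are (proper and) defined as for rings. $\mathrm{Spec}(R)$ is the set of prime ideals with the Zariski topology (closed sets $V(I)=\{P: I\subseteq P\}$ for ideals $I$); the sets $\mathrm{Max}(R)$ of maximal ideals (all of which are prime) and $\mathrm{Min}(R)$ of minimal prime ideals carry the subspace topology. $K.\dim(R)$ is the supremum of the lengths $n$ of chains $P_0\subsetneq\dots\subsetneq P_n$ of prime ideals. A minimal prime is absolutely minimal iff it does not contain the intersection of all the other minimal primes; a maximal ideal is barely maximal iff it does not contain the intersection of all the other maximal ideals (the empty intersection being $R$). $R$ is: PAMin iff every prime ideal is an absolutely minimal (minimal) prime; PBMax iff every prime ideal is a barely maximal (maximal) ideal; AMin iff every minimal prime is absolutely minimal; BMax iff every maximal ideal is barely maximal; FMax iff $\mathrm{Max}(R)$ is finite; FMin iff $\mathrm{Min}(R)$ is finite. Two points of a space are topologically distinguishable iff some open set contains exactly one of them. A space is $R_0$ iff for any two topologically distinguishable points $x,y$ there are open $U_x\ni x$, $U_y\ni y$ with $y\notin U_x$, $x\notin U_y$; it is $R_1$ iff any two topologically distinguishable points have disjoint open neighborhoods. *)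

(* Defs.v *)
From HB Require Import structures.
From mathcomp Require Import all_boot all_order all_algebra.
From mathcomp Require Import boolp classical_sets cardinality constructive_ereal.
From mathcomp Require Import topology.

Set Implicit Arguments.
Unset Strict Implicit.
Unset Printing Implicit Defensive.

Import GRing.Theory.
Local Open Scope classical_set_scope.
Local Open Scope ring_scope.

Section Ideals.
Variable R : comNzSemiRingType.
Implicit Types I J P Q M N : set R.

Definition is_ideal I : Prop :=
  [/\ I 0, forall x y, I x -> I y -> I (x + y) & forall a x, I x -> I (a * x)].

Definition prime_ideal P : Prop :=
  [/\ is_ideal P, P <> setT & forall x y, P (x * y) -> P x \/ P y].

Definition maximal_ideal M : Prop :=
  [/\ is_ideal M, M <> setT &
      forall J, is_ideal J -> J <> setT -> M `<=` J -> J = M].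

Definition minimal_prime P : Prop :=
  prime_ideal P /\ forall Q, prime_ideal Q -> Q `<=` P -> Q = P.

(* A [\bigcap] over an empty family is [setT], i.e. the whole of R. *)
Definition absolutely_minimal P : Prop :=
  minimal_prime P /\ ~ \bigcap_(Q in minimal_prime `\ P) Q `<=` P.

Definition barely_maximal M : Prop :=
  maximal_ideal M /\ ~ \bigcap_(N in maximal_ideal `\ M) N `<=` M.

Lemma proper_ideal1 I : is_ideal I -> I <> setT -> ~ I 1.
Proof.
move=> [_ _ IM] IT I1; apply: IT; rewrite -subTset => x _.
by rewrite -(mulr1 x); exact: IM.
Qed.

Lemma maximal_ideal_prime M : maximal_ideal M -> prime_ideal M.
Proof.
move=> [iM MT Mmax]; split=> // x y Mxy; have [M0 MD MM] := iM.
have [Mx|nMx] := pselect (M x); [by left|right].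
pose J : set R := [set z | exists2 m, M m & exists r, z = m + r * x].
have iJ : is_ideal J.
  split.
  - by exists 0 => //; exists 0; rewrite mul0r addr0.
  - move=> _ _ [m Mm [r ->]] [m' Mm' [r' ->]].
    exists (m + m'); first exact: MD.
    by exists (r + r'); rewrite mulrDl addrACA.
  - move=> a _ [m Mm [r ->]]; exists (a * m); first exact: MM.
    by exists (a * r); rewrite mulrDr mulrA.
have [JT|JT] := pselect (J = setT).
  have [m Mm [r e1]] : J 1 by rewrite JT.
  rewrite -(mulr1 y) e1 mulrDr; apply: MD; first exact: MM.
  by rewrite mulrCA (mulrC y); exact: MM.
exfalso; apply: nMx; rewrite -(Mmax J iJ JT).
  by exists 0 => //; exists 1; rewrite add0r mul1r.
by move=> m Mm; exists m => //; exists 0; rewrite mul0r addr0.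
Qed.

End Ideals.

Definition spec (R : comNzSemiRingType) : Type := {P : set R | prime_ideal P}.

Definition spec_set (R : comNzSemiRingType) (P : spec R) : set R := sval P.
Coercion spec_set : spec >-> set.

Section Zariski.
Variable R : comNzSemiRingType.

Definition zero_locus (I : set R) : set (spec R) := [set P : spec R | I `<=` P].

Definition zariski_open : set_system (spec R) :=
  [set ~` zero_locus I | I in @is_ideal R].

Lemma zariski_openT : zariski_open setT.
Proof.
exists setT; first by [].
rewrite -subTset => -[P pP] _ TP; have [_ + _] := pP; apply.
by rewrite -subTset.
Qed.

Lemma zariski_openI : setI_closed zariski_open.
Proof.
move=> _ _ [I [I0 ID IM] <-] [J [J0 JD JM] <-]; exists (I `&` J).
  split; first by [].
  - by move=> x y [Ix Jx] [Iy Jy]; split; [exact: ID|exact: JD].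
  - by move=> a x [Ix Jx]; split; [exact: IM|exact: JM].
rewrite -setCU; congr (~` _); apply/seteqP; split => -[P pP].
- have [_ _ pM] := pP => IJP; have [IP|/existsNP[x]] := pselect (I `<=` P).
    by left.
  move=> /not_implyP[Ix nPx]; right => y Jy.
  have /pM[] // : P (x * y).
  by apply: IJP; split; [rewrite mulrC; exact: IM|exact: JM].
- by move=> [IP|JP] x [Ix Jx]; [exact: IP|exact: JP].
Qed.

Lemma zariski_open_bigU (A : Type) (f : A -> set (spec R)) :
  (forall i, zariski_open (f i)) -> zariski_open (\bigcup_i f i).
Proof.
move=> fo; have /choice[F fF] : forall i, exists I : set R,
    is_ideal I /\ ~` zero_locus I = f i.
  by move=> i; have [I iI <-] := fo i; exists I.
exists (\bigcap_(J in [set J | is_ideal J /\ forall i, F i `<=` J]) J).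
  split.
  - by move=> J [[]].
  - move=> x y Jx Jy J iJ; have [[_ JD _] _] := iJ.
    by apply: JD; [exact: Jx|exact: Jy].
  - by move=> a x Jx J iJ; have [[_ _ JM] _] := iJ; apply: JM; exact: Jx.
have -> : \bigcup_i f i = ~` \bigcap_i zero_locus (F i).
  by rewrite setC_bigcap; apply: eq_bigcupr => i _; rewrite (fF i).2.
congr (~` _); apply/seteqP; split => -[P pP].
- by move=> JP i _ x Fx; apply: JP => J [_ FJ]; exact: (FJ i).
- move=> FP x Jx; apply: Jx; split; first by have [] := pP.
  by move=> i y Fy; exact: (FP i I y Fy).
Qed.

HB.instance Definition _ := gen_eqMixin (spec R).
HB.instance Definition _ := gen_choiceMixin (spec R).
HB.instance Definition _ := isOpenTopological.Build (spec R)
  zariski_openT zariski_openI zariski_open_bigU.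

End Zariski.

(* As sets of points of [spec R]; used as types, these are [set_type]s and carry
   the subspace topology. By [maximal_ideal_prime] no maximal ideal is lost. *)
Definition Max (R : comNzSemiRingType) : set (spec R) :=
  [set P : spec R | maximal_ideal P].

Definition Min (R : comNzSemiRingType) : set (spec R) :=
  [set P : spec R | minimal_prime P].

Arguments Max : clear implicits.
Arguments Min : clear implicits.

Section SemiringConditions.
Variable R : comNzSemiRingType.

Definition PAMin : Prop :=
  forall P : set R, prime_ideal P -> absolutely_minimal P.

Definition PBMax : Prop :=
  forall P : set R, prime_ideal P -> barely_maximal P.

Definition AMin : Prop :=
  forall P : set R, minimal_prime P -> absolutely_minimal P.

Definition BMax : Prop :=
  forall M : set R, maximal_ideal M -> barely_maximal M.

Definition FMax : Prop := finite_set (Max R).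

Definition FMin : Prop := finite_set (Min R).

Definition has_prime_chain (n : nat) : Prop :=
  exists P : nat -> spec R,
    forall i, (i < n)%N -> (P i : set R) `<` (P i.+1 : set R).

(* The supremum in the extended integers, +oo when chains are arbitrarily long. *)
Definition krull_dim : \bar int :=
  supremum -oo%E [set (n%:Z)%:E | n in has_prime_chain].

End SemiringConditions.

Section Spaces.
Variable T : topologicalType.

(* The defining equation of the library's [discreteTopologicalType]. *)
Definition discrete_space : Prop := @nbhs T T = @principal_filter T.

Definition topologically_distinguishable (x y : T) : Prop :=
  exists U : set T, open U /\ (U x /\ ~ U y \/ U y /\ ~ U x).

Definition R0_space : Prop :=
  forall x y : T, topologically_distinguishable x y ->
    exists U V : set T, [/\ open U /\ open V, U x, V y, ~ U y & ~ V x].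

Definition R1_space : Prop :=
  forall x y : T, topologically_distinguishable x y ->
    exists U V : set T, [/\ open U, open V, U x, V y & U `&` V = set0].

End Spaces.

Arguments discrete_space : clear implicits.
Arguments R0_space : clear implicits.
Arguments R1_space : clear implicits.
Arguments PAMin : clear implicits.
Arguments PBMax : clear implicits.
Arguments AMin : clear implicits.
Arguments BMax : clear implicits.
Arguments FMax : clear implicits.
Arguments FMin : clear implicits.
Arguments has_prime_chain : clear implicits.
Arguments krull_dim : clear implicits.

(* Main.v *)
(* Every condition is equivalent to Spec(R) being discrete.  A prime P is isolated
   in Spec(R) iff it does not contain the intersection of the other primes, and
   each separation axiom, as well as K.dim(R) = 0, forbids strict inclusions
   between primes, so that Spec(R), Max(R) and Min(R) coincide.  If Spec(R) is
   discrete, the elements lying in all but finitely many primes form an ideal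
   contained in no prime; hence it contains 1 and Spec(R) is finite.  Conversely,
   if there are finitely many primes, pairwise incomparable, then a product of
   elements separating P from each other prime shows that P is isolated. *)
Require Import Defs.
From mathcomp Require Import all_boot all_order all_algebra.
From mathcomp Require Import boolp classical_sets functions cardinality constructive_ereal.
From mathcomp Require Import topology.

Import GRing.Theory.

Local Open Scope classical_set_scope.
Local Open Scope ring_scope.

(** * Discreteness and separation axioms *)

Section Topology.
Set Implicit Arguments.
Unset Strict Implicit.
Variable T : topologicalType.

(** Trades the equality of filters for isolated points, the form that can be tested prime by
    prime. *)
Lemma discrete_spaceP : discrete_space T <-> forall x : T, open [set x].
Proof.
split=> [dT x|oT].
  have : nbhs x [set x] by rewrite dT.
  rewrite nbhsE => -[B [oB Bx] BE].
  suff <- : B = [set x] by [].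
  by apply/seteqP; split=> // _ ->.
apply/funext => x; apply/funext => A; apply/propext; split=> [Ax _ ->|].
  exact: nbhs_singleton.
by move=> Ax; rewrite nbhsE; exists [set x] => //; split.
Qed.

Lemma discrete_space_hausdorff : discrete_space T -> hausdorff_space T.
Proof.
move=> /discrete_spaceP oT; rewrite open_hausdorff => x y xy.
exists ([set x], [set y]); first by rewrite !inE.
split=> //=; apply/eqP/seteqP; split=> // z [/= -> xyE].
by move: xy; rewrite xyE eqxx.
Qed.

Lemma distinguishable_neq (x y : T) :
  topologically_distinguishable x y -> x != y.
Proof.
move=> [U [_ UxUy]]; apply/eqP => xy.
by move: UxUy; rewrite xy => -[[]|[]].
Qed.

Lemma hausdorff_R1 : hausdorff_space T -> R1_space T.
Proof.
rewrite open_hausdorff => hT x y /distinguishable_neq/hT[[U V] /=].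
by move=> [/set_mem Ux /set_mem Vy] [oU oV /eqP UV]; exists U, V.
Qed.

Lemma R1_R0 : R1_space T -> R0_space T.
Proof.
move=> r1 x y /r1[U [V [oU oV Ux Vy UV]]]; exists U, V; split=> // [Uy|Vx].
- by rewrite -[False]/(set0 y) -UV.
- by rewrite -[False]/(set0 x) -UV.
Qed.

Lemma accessible_R0 : accessible_space T -> R0_space T.
Proof.
move=> t1 x y /distinguishable_neq xy.
have [U [oU Ux Uy]] := t1 _ _ xy.
rewrite eq_sym in xy; have [V [oV Vy Vx]] := t1 _ _ xy.
by exists U, V; split=> //; move: Ux Uy Vx Vy; rewrite !inE.
Qed.

End Topology.

(** * Discreteness of subspaces *)

Section SubspaceTopology.
Set Implicit Arguments.
Unset Strict Implicit.
Variable T : topologicalType.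

Lemma discrete_set_type (A : set T) :
  discrete_space T -> discrete_space (set_type A).
Proof.
move=> /discrete_spaceP oT; apply/discrete_spaceP => x.
exists [set set_val x]; first exact: oT.
by apply/seteqP; split=> [y /val_inj|y ->].
Qed.

(** Needed when [Max R] or [Min R] is the whole spectrum. An open singleton of the subspace is the
    preimage of an open [U] of [T], and no point of [U] is lost because [A] is everything. *)
Lemma set_type_setT_discrete (A : set T) :
  A = setT -> discrete_space (set_type A) -> discrete_space T.
Proof.
move=> AT /discrete_spaceP oA; apply/discrete_spaceP => x.
have Ax : x \in A by rewrite AT inE.
have [U oU UE] := oA (SigSub Ax).
suff <- : U = [set x] by [].
apply/seteqP; split=> [y Uy|_ ->].
  have Ay : y \in A by rewrite AT inE.
  have : (set_val @^-1` U) (SigSub Ay) by [].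
  by rewrite UE => /(congr1 val).
by have : (set_val @^-1` U) (SigSub Ax) by rewrite UE.
Qed.

End SubspaceTopology.

(** * Existence of maximal ideals, and incomparable primes *)

Section Spectrum.
Set Implicit Arguments.
Unset Strict Implicit.
Variable R : comNzSemiRingType.
Implicit Types (I J M : set R) (P Q : spec R).

Lemma ideal_sub_maximal I :
  is_ideal I -> ~ I 1 -> exists2 M, maximal_ideal M & I `<=` M.
Proof.
move=> [I0 ID IM] I1.
(* Zorn's lemma is applied to the sets J such that I `|` J is a proper ideal,
   because the union of the empty chain is set0. *)
pose proper J := is_ideal (I `|` J) /\ ~ (I `|` J) 1.
have [F Fp Ft|A [[iA A1] Amax]] := @Zorn_bigcup R proper.
  split; last by move=> [//|[X /Fp[_ X1] X1']]; apply: X1; right.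
  split; first by left.
  - move=> x y [Ix|[X FX Xx]] [Iy|[Y FY Yy]].
    + by left; exact: ID.
    + have [[_ YD _] _] := Fp _ FY.
      have [|Yxy] := YD x y (or_introl Ix) (or_intror Yy); first by left.
      by right; exists Y.
    + have [[_ XD _] _] := Fp _ FX.
      have [|Xxy] := XD x y (or_intror Xx) (or_introl Iy); first by left.
      by right; exists X.
    (* The family is a chain, so both summands may be taken in its larger member [Y]. *)
    + wlog XY : x y X Y FX Xx FY Yy / X `<=` Y.
        move=> wl; have [XY|YX] := Ft _ _ FX FY; first exact: (wl x y X Y).
        by rewrite addrC; exact: (wl y x Y X).
      have [[_ YD _] _] := Fp _ FY.
      have [|Yxy] := YD x y (or_intror (XY _ Xx)) (or_intror Yy); first by left.
      by right; exists Y.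
  - move=> a x [Ix|[X FX Xx]]; first by left; exact: IM.
    have [[_ _ XM] _] := Fp _ FX.
    have [|Xax] := XM a x (or_intror Xx); first by left.
    by right; exists X.
exists (I `|` A); last exact: subsetUl.
split=> // [AT|J iJ JT AJ]; first by apply: A1; rewrite AT.
have IJ : I `|` J = J by apply/setUidr => x Ix; apply: AJ; left.
(* An element of [J] outside [A] would make [J] strictly larger than [A], yet [J] is still [proper]
   since it contains [I]. *)
apply/seteqP; split=> // x Jx; right; apply: contrapT => nAx.
apply: (Amax J); last by rewrite /proper IJ; split=> //; exact: proper_ideal1.
by split=> [y Ay|JA]; [apply: AJ; right|apply: nAx; exact: JA].
Qed.

(** As 1 is not 0, the zero ideal is proper. The resulting point is the chain of length 0 that keeps
    [krull_dim] from being [-oo]. *)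
Lemma spec_inhabited : exists P, maximal_ideal P.
Proof.
have [||M mM _] := @ideal_sub_maximal [set 0]; last first.
- by exists (exist _ M (maximal_ideal_prime mM)).
- by move=> /= /eqP; rewrite oner_eq0.
- by split=> //= [x y -> ->|a x ->]; rewrite ?addr0 ?mulr0.
Qed.

Lemma spec_eq P Q : P = Q :> set R -> P = Q.
Proof.
by case: P Q => [P pP] [Q pQ] /= PQ; subst Q; congr exist;
  exact: Prop_irrelevance.
Qed.

(** Stands in for [krull_dim R = 0], with which [krull_dim0] identifies it; it avoids chains and
    suprema. *)
Definition zero_dim : Prop := forall P Q, P `<=` Q -> P = Q.

(** A proper ideal [J] above the prime [P] lies in a maximal, hence prime, ideal [M]; then [P = M],
    which squeezes [J] in between. *)
Lemma zero_dim_Max : zero_dim -> Max R = setT.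
Proof.
move=> zd; apply/seteqP; split=> // -[P pP] _; have [iP PT _] := pP.
split=> //= J iJ JT PJ.
have [M mM JM] := ideal_sub_maximal iJ (proper_ideal1 iJ JT).
have /(congr1 (@spec_set R)) /= PM :=
  zd (exist _ P pP) (exist _ M (maximal_ideal_prime mM)) (subset_trans PJ JM).
by apply/seteqP; split=> //; rewrite PM.
Qed.

Lemma zero_dim_Min : zero_dim -> Min R = setT.
Proof.
move=> zd; apply/seteqP; split=> // -[P pP] _; split=> //= Q pQ QP.
by have /(congr1 (@spec_set R)) := zd (exist _ Q pQ) (exist _ P pP) QP.
Qed.

Lemma zero_dim_maximal_ideal : zero_dim -> @maximal_ideal R = @prime_ideal R.
Proof.
move=> zd; apply/seteqP; split=> P; first exact: maximal_ideal_prime.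
by move=> pP; have : Max R (exist _ P pP) by rewrite zero_dim_Max.
Qed.

Lemma zero_dim_minimal_prime : zero_dim -> @minimal_prime R = @prime_ideal R.
Proof.
move=> zd; apply/seteqP; split=> P; first by case.
by move=> pP; have : Min R (exist _ P pP) by rewrite zero_dim_Min.
Qed.

Lemma maximal_zero_dim :
  (forall M, prime_ideal M -> maximal_ideal M) -> zero_dim.
Proof.
move=> pm P Q PQ; apply: spec_eq.
have [_ _ Pmax] := pm _ (svalP P); have [iQ QT _] := svalP Q.
by rewrite (Pmax Q).
Qed.

Lemma minimal_zero_dim :
  (forall M, prime_ideal M -> minimal_prime M) -> zero_dim.
Proof.
move=> pm P Q PQ; apply: spec_eq.
by have [_ Qmin] := pm _ (svalP Q); exact: Qmin (svalP P) PQ.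
Qed.

(** * Separation and isolated points in the Zariski topology *)

Lemma open_zariski_down (U : set (spec R)) P Q :
  open U -> P `<=` Q -> U Q -> U P.
Proof. by move=> [I _ <-] PQ IQ IP; apply: IQ; exact: subset_trans PQ. Qed.

(** If [P] is strictly inside [Q], the complement of [zero_locus Q] contains [P] but not [Q], while
    every open set around [Q] contains [P]. *)
Lemma R0_zero_dim : R0_space (spec R) -> zero_dim.
Proof.
move=> r0 P Q PQ; apply: spec_eq; apply/seteqP; split=> //.
apply: contrapT => QP.
have [|U [V [[_ oV] _ VQ _]]] := r0 P Q; last first.
  by apply; exact: open_zariski_down PQ VQ.
exists (~` zero_locus Q); split; last by left; split=> //; apply.
by exists Q => //; have [] := svalP Q.
Qed.

(** Among the ideals contained in all primes other than [P], the intersection of these primes is the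
    largest, so it is the best candidate for an ideal whose zero locus omits only [P]. *)
Lemma open_set1_spec P :
  open [set P] <-> ~ \bigcap_(Q in @prime_ideal R `\ (P : set R)) Q `<=` P.
Proof.
split=> [[I iI IE] bP|bP].
  have : (~` zero_locus I) P by rewrite IE.
  apply; apply: subset_trans bP => x Ix Q [pQ QP].
  have : ~ (~` zero_locus I) (exist _ Q pQ).
    by rewrite IE => /(congr1 (@spec_set R)).
  by move=> /contrapT; exact.
exists (\bigcap_(Q in @prime_ideal R `\ (P : set R)) Q).
  split; first by move=> Q [[[]]].
  - move=> x y xb yb Q QP; have [[[_ QD _] _ _] _] := QP.
    by apply: QD; [exact: xb|exact: yb].
  - by move=> a x xb Q QP; have [[[_ _ QM] _ _] _] := QP; apply: QM; exact: xb.
apply/seteqP; split=> [Q bQ|_ ->//].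
apply: contrapT => QP; apply: bQ => x; apply; split; first exact: svalP.
by move=> /spec_eq.
Qed.

Lemma discrete_specP : discrete_space (spec R) <->
  forall I, prime_ideal I -> ~ \bigcap_(J in @prime_ideal R `\ I) J `<=` I.
Proof.
rewrite discrete_spaceP; split=> [oP I pI|bP P].
  exact/(open_set1_spec (exist _ I pI)).
by apply/open_set1_spec/bP/svalP.
Qed.

(** Once every prime is minimal, the intersection in [absolutely_minimal] runs over all other
    primes, as in [discrete_specP]. *)
Lemma zero_dim_AMin : zero_dim -> AMin R <-> discrete_space (spec R).
Proof.
move=> /zero_dim_minimal_prime zd.
rewrite discrete_specP /AMin /absolutely_minimal zd.
by split=> dR P pP; [have [] := dR P pP|split=> //; exact: dR].
Qed.

Lemma zero_dim_BMax : zero_dim -> BMax R <-> discrete_space (spec R).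
Proof.
move=> /zero_dim_maximal_ideal zd.
rewrite discrete_specP /BMax /barely_maximal zd.
by split=> dR P pP; [have [] := dR P pP|split=> //; exact: dR].
Qed.

Lemma discrete_zero_dim : discrete_space (spec R) -> zero_dim.
Proof. by move=> /discrete_space_hausdorff/hausdorff_R1/R1_R0/R0_zero_dim. Qed.

Lemma discrete_finite_spec :
  discrete_space (spec R) -> finite_set [set: spec R].
Proof.
move=> /discrete_specP dR.
pose J : set R := [set x | finite_set [set P : spec R | ~ spec_set P x]].
have iJ : is_ideal J.
  split.
  - apply: (sub_finite_set _ (finite_set0 (spec R))) => P; apply.
    by have [[]] := svalP P.
  (* A prime missing [x + y] misses [x] or [y], so the exceptional primes lie in a union of two
     finite sets. *)
  - move=> x y Jx Jy; have := conj Jx Jy; rewrite -finite_setU.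
    apply: sub_finite_set => P /= nPxy; apply/not_andP => -[Px Py].
    by apply: nPxy; have [[_ PD _] _ _] := svalP P; exact: PD.
  - move=> a x; apply: sub_finite_set => P /= nPax Px; apply: nPax.
    by have [[_ _ PM] _ _] := svalP P; exact: PM.
have J1 : J 1.
  apply: contrapT => /(ideal_sub_maximal iJ)[M /maximal_ideal_prime pM JM].
  (* An element of all primes other than [M] is missed at most by [M], hence lies in [J] and so in
     [M]; but [M] is isolated. *)
  apply: (dR M pM) => x xb; apply: JM.
  apply: (sub_finite_set _ (finite_set1 (exist _ M pM : spec R))).
  move=> P /= nPx; apply: contrapT => PM; apply: nPx.
  by apply: xb; split; [exact: svalP|move=> PE; apply: PM; exact: spec_eq].
(* No prime contains 1, so the finite set attached to 1 is the whole spectrum. *)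
by apply: sub_finite_set J1 => P _; have [iP PT _] := svalP P;
  exact: proper_ideal1.
Qed.

Lemma finite_discrete_spec :
  zero_dim -> finite_set [set: spec R] -> discrete_space (spec R).
Proof.
move=> zd /finite_seqP[s sT]; apply/discrete_specP => I pI.
pose P : spec R := exist _ I pI.
suff [x nPx xs] : exists2 x, ~ I x &
    forall Q, Q \in s -> Q <> P -> spec_set Q x.
  move=> bI; apply: nPx; apply: bI => J [pJ JI].
  apply: (xs (exist _ J pJ)); last by move=> /(congr1 (@spec_set R)).
  by have : [set: spec R] (exist _ J pJ) by []; rewrite sT.
elim: s {sT} => [|Q s [x nIx xs]].
  by exists 1 => //; have [iI IT _] := pI; exact: proper_ideal1.
have [->|QP] := pselect (Q = P).
  by exists x => // Q'; rewrite inE => /predU1P[->//|]; exact: xs.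
have /existsNP[y /not_implyP[Qy nIy]] : ~ (spec_set Q `<=` I).
  by move=> QI; apply: QP; exact: zd.
(* Primality keeps the product outside [I]; the factor [y] puts it in [Q], the factor [x] in the
   primes already treated. *)
exists (y * x); first by have [_ _ IM] := pI; move=> /IM[].
move=> Q'; rewrite inE => /predU1P[-> _|Q's Q'P].
  by rewrite mulrC; have [[_ _ QM] _ _] := svalP Q; exact: QM.
by have [[_ _ QM] _ _] := svalP Q'; apply: QM; exact: xs.
Qed.

(** * Krull dimension zero *)

Lemma has_prime_chainSP n :
  zero_dim -> has_prime_chain R n -> n = 0%N.
Proof.
case: n => // n zd [P chP]; have [/zd ->] := chP 0%N isT; by case.
Qed.

Lemma krull_dim0 : krull_dim R = 0%E <-> zero_dim.
Proof.
split=> [d0 P Q PQ|zd].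
  apply: contrapT => nPQ.
  (* The default value of [supremum] is [-oo]; the value 0 excludes it, so [krull_dim R] is a
     genuine upper bound. *)
  have : ubound [set (n%:Z)%:E | n in has_prime_chain R] (krull_dim R).
    move: d0; rewrite /krull_dim /supremum; case: ifP => // _.
    by case: xgetP => [? -> []|].
  move=> /(_ 1%:E) ub; suff : (1%:E <= krull_dim R)%E by rewrite d0.
  (* A strict inclusion of [P] in [Q] is a chain of length 1; only the indices 0 and 1 matter. *)
  apply: ub; exists 1%N => //; exists (fun i => if i == 0%N then P else Q).
  by case=> // _; split=> // QP; apply/nPQ/spec_eq/seteqP.
rewrite /krull_dim (_ : [set _ | _ in _] = [set 0%E]) ?supremum1 //.
apply/seteqP; split=> [_ [n /(has_prime_chainSP zd) -> <-]//|_ ->].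
by have [P _] := spec_inhabited; exists 0%N => //; exists (fun=> P).
Qed.

End Spectrum.

Theorem theorem2p30 (R : comNzSemiRingType) :
  [<-> (* (1) *)  PAMin R;
       (* (2) *)  PBMax R;
       (* (3) *)  discrete_space (spec R);
       (* (4) *)  discrete_space (spec R) /\ finite_set [set: spec R];
       (* (5) *)  finite_set [set: spec R] /\ accessible_space (spec R);
                  finite_set [set: spec R] /\ R0_space (spec R);
                  finite_set [set: spec R] /\ R1_space (spec R);
                  finite_set [set: spec R] /\ hausdorff_space (spec R);
       (* (6) *)  FMax R /\ accessible_space (spec R);
                  FMax R /\ R0_space (spec R);
                  FMax R /\ R1_space (spec R);
                  FMax R /\ hausdorff_space (spec R);
       (* (7) *)  discrete_space (set_type (Max R)) /\ krull_dim R = 0%E;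
       (* (8) *)  BMax R /\ krull_dim R = 0%E;
       (* (9) *)  FMin R /\ accessible_space (spec R);
                  FMin R /\ R0_space (spec R);
                  FMin R /\ R1_space (spec R);
                  FMin R /\ hausdorff_space (spec R);
       (* (10) *) discrete_space (set_type (Min R)) /\ krull_dim R = 0%E;
       (* (11) *) AMin R /\ krull_dim R = 0%E].
Proof.
have fin_dR : finite_set [set: spec R] /\ zero_dim R -> discrete_space (spec R).
  by move=> [fR zR]; exact: finite_discrete_spec.
have dR_fin : discrete_space (spec R) -> finite_set [set: spec R].
  exact: discrete_finite_spec.
have dR_FMax : discrete_space (spec R) -> FMax R.
  by move=> /dR_fin; apply: sub_finite_set.
have dR_FMin : discrete_space (spec R) -> FMin R.
  by move=> /dR_fin; apply: sub_finite_set.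
have FMax_dR : FMax R /\ zero_dim R -> discrete_space (spec R).
  by move=> [fR zR]; apply: fin_dR; rewrite -(zero_dim_Max zR).
have FMin_dR : FMin R /\ zero_dim R -> discrete_space (spec R).
  by move=> [fR zR]; apply: fin_dR; rewrite -(zero_dim_Min zR).
(* Handles the four separation axioms uniformly in the finiteness condition [F]: discreteness gives
   T2, T2 gives both T1 and R1, each of these gives R0, and R0 gives [zero_dim]. *)
have sep (F : Prop) : (discrete_space (spec R) -> F) ->
    (F /\ zero_dim R -> discrete_space (spec R)) ->
    [/\ F /\ accessible_space (spec R) <-> discrete_space (spec R),
       F /\ R0_space (spec R) <-> discrete_space (spec R),
       F /\ R1_space (spec R) <-> discrete_space (spec R) &
       F /\ hausdorff_space (spec R) <-> discrete_space (spec R)].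
  have ht := @discrete_space_hausdorff (spec R).
  have hr1 := @hausdorff_R1 (spec R).
  have r1r0 := @R1_R0 (spec R).
  have ha := @hausdorff_accessible (spec R).
  have ar0 := @accessible_R0 (spec R).
  have r0z := @R0_zero_dim R.
  split; tauto.
have [h5 h5' h5'' h5'''] := sep _ dR_fin fin_dR.
have [h6 h6' h6'' h6'''] := sep _ dR_FMax FMax_dR.
have [h9 h9' h9'' h9'''] := sep _ dR_FMin FMin_dR.
have h4 : discrete_space (spec R) /\ finite_set [set: spec R] <->
    discrete_space (spec R) by tauto.
have dz := @discrete_zero_dim R.
have kz := krull_dim0 R.
have h7 : discrete_space (set_type (Max R)) /\ krull_dim R = 0%E <->
    discrete_space (spec R).
  split=> [[dM /kz/zero_dim_Max MT]|dR].
    exact: set_type_setT_discrete MT dM.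
  by split; [exact: discrete_set_type|exact/kz/dz].
have h10 : discrete_space (set_type (Min R)) /\ krull_dim R = 0%E <->
    discrete_space (spec R).
  split=> [[dM /kz/zero_dim_Min MT]|dR].
    exact: set_type_setT_discrete MT dM.
  by split; [exact: discrete_set_type|exact/kz/dz].
have h11 : AMin R /\ krull_dim R = 0%E <-> discrete_space (spec R).
  split=> [[+ /kz zR]|dR]; first by rewrite zero_dim_AMin.
  by have zR := dz dR; rewrite zero_dim_AMin //; split=> //; exact/kz.
have h8 : BMax R /\ krull_dim R = 0%E <-> discrete_space (spec R).
  split=> [[+ /kz zR]|dR]; first by rewrite zero_dim_BMax.
  by have zR := dz dR; rewrite zero_dim_BMax //; split=> //; exact/kz.
have h1 : PAMin R <-> discrete_space (spec R).
  (* [PAMin] amounts to [AMin] together with minimality of every prime, and the latter is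
     [zero_dim]. *)
  rewrite -h11 kz; split=> [pR|[aR zR] P].
    by split=> [P [/pR]//|]; apply: minimal_zero_dim => P /pR[].
  by rewrite -(zero_dim_minimal_prime zR); exact: aR.
have h2 : PBMax R <-> discrete_space (spec R).
  rewrite -h8 kz; split=> [pR|[bR zR] P].
    split=> [P /maximal_ideal_prime/pR//|].
    by apply: maximal_zero_dim => P /pR[].
  by rewrite -(zero_dim_maximal_ideal zR); exact: bR.
(* Each condition is replaced by discreteness of the spectrum, so the cycle becomes trivial. *)
rewrite (propext h1) (propext h2) (propext h4).
rewrite (propext h5) (propext h5') (propext h5'') (propext h5''').
rewrite (propext h6) (propext h6') (propext h6'') (propext h6''').
rewrite (propext h7) (propext h8).
rewrite (propext h9) (propext h9') (propext h9'') (propext h9''').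
rewrite (propext h10) (propext h11).
by tfae.
Qed.
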